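(* Let $n\geq 3$ and $\ell_1,\ldots,\ell_n\in\mathbb{R}_{>0}$. There exists a Euclidean cyclic polygon with $n$ sides of lengths $\ell_1,\ldots,\ell_n$ (in this cyclic order) if and only if for all $k\in\{1,\ldots,n\}$ $$\ell_k<\sum_{\substack{i=1\\ i\neq k}}^{n}\ell_i,$$ and in this case the cyclic polygon is unique (up to isometries of the Euclidean plane).
   Context: A Euclidean cyclic polygon is a convex polygon in the Euclidean plane $\mathbb{R}^2$ that is inscribed in a circle: it is given by $n$ distinct points $p_1,\ldots,p_n$ that lie in this cyclic order on a circle of some radius $R>0$, and its sides are the straight line segments $p_kp_{k+1}$ (indices modulo $n$), the $k$-th side having length $\ell_k=|p_{k+1}-p_k|$. (The center of the circle need not lie inside the polygon.) Two polygons are identified if an isometry of the plane maps one to the other, respecting the labelling of the sides. *)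

(* Defs.v *)
From mathcomp Require Export all_boot all_order all_algebra.
From mathcomp Require Export reals trigo.

Set Implicit Arguments.
Unset Strict Implicit.
Unset Printing Implicit Defensive.

Import Order.TTheory GRing.Theory Num.Theory.
Local Open Scope ring_scope.

(* The library's norm on R * R is the sup norm, so the Euclidean distance is
   written out. *)
Definition edist (R : realType) (x y : R * R) : R :=
  Num.sqrt ((x.1 - y.1) ^+ 2 + (x.2 - y.2) ^+ 2).

Definition plane_isometry (R : realType) (f : R * R -> R * R) : Prop :=
  bijective f /\ forall x y, edist (f x) (f y) = edist x y.

Definition circle_point (R : realType) (c : R * R) (r t : R) : R * R :=
  (c.1 + r * cos t, c.2 + r * sin t).

Definition one_turn (R : realType) (n : nat) (t : 'I_n -> R) : Prop :=
  forall i j : 'I_n, (i < j)%N -> t i < t j < t i + 2 * pi.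

(* The strict inequalities in one_turn make the points pairwise distinct.  The
   two disjuncts are the counterclockwise and the clockwise order. *)
Definition in_cyclic_order (R : realType) (n : nat) (c : R * R) (r : R)
    (p : 'I_n -> R * R) : Prop :=
  exists t : 'I_n -> R,
    (one_turn t \/ one_turn (fun k => - t k)) /\
    forall k, p k = circle_point c r (t k).

(* A polygon is its labelled family of vertices p.  Convexity is not imposed: it
   follows from the cyclic order of the vertices on the circle. *)
Definition cyclic_polygon (R : realType) (n : nat) (p : 'I_n -> R * R) : Prop :=
  exists (c : R * R) (r : R), 0 < r /\ in_cyclic_order c r p.

Definition side_length (R : realType) (n : nat) (p : 'I_n -> R * R)
    (k : 'I_n) : R := edist (p (ordS k)) (p k).

Definition has_side_lengths (R : realType) (n : nat) (p : 'I_n -> R * R)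
    (l : 'I_n -> R) : Prop := forall k, side_length p k = l k.

Definition congruent (R : realType) (n : nat) (p q : 'I_n -> R * R) : Prop :=
  exists f : R * R -> R * R, plane_isometry f /\ forall k, f (p k) = q k.

(* Main.v *)
From mathcomp Require Import classical_sets topology normedtype.
From mathcomp Require Import derive realfun ring lra.
Require Import Defs.

Set Implicit Arguments.
Unset Strict Implicit.
Unset Printing Implicit Defensive.

Import Order.TTheory GRing.Theory Num.Theory.
Import numFieldNormedType.Exports.
Local Open Scope ring_scope.

(** The [k]-th side of a polygon inscribed in a circle of diameter [d] is the
    chord of a central angle [2 * a k], so it has length [d * sin (a k)]; the
    vertices run once around the circle exactly when the [a k] are positive and
    add up to [pi].  Up to isometry the polygon is determined by [d] and the
    [a k] ([cyclic_polygon_inscribed], [inscribed_congruent]), and conversely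
    every such system of angles comes from a polygon
    ([inscribed_cyclic_polygon]).  Hence the theorem is about solving
    [l k = d * sin (a k)] with [a k > 0] and [\sum_k a k = pi].

    Necessity.  Since [sin (a k) = sin (\sum_(i != k) a i)], the polygon
    inequality is the strict subadditivity of [sin] on [[0, pi]].

    Existence.  Let [m] be a longest side.  Only [a m] can be obtuse, so taking
    it as the unknown [x] removes every case distinction: the other angles have
    to be [asin (l i / l m * sin x)], and one needs [0 < x < pi] where
    [F x := x + \sum_(i != m) asin (l i / l m * sin x)] equals [pi].  Now
    [F 0 = 0], but [F pi = pi] is a degenerate solution; the polygon inequality
    says that the sum of the ratios [l i / l m] exceeds [1], and therefore [F]
    exceeds [pi] somewhere to the left of [pi].  The intermediate value theorem
    then provides a solution in the open interval.

    Uniqueness.  Let [a], [d] and [b], [e] be two solutions with [e <= d], so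
    that [sin (b k) = lam * sin (a k)] with [lam = d / e >= 1].  If [a k] is
    acute then [a k <= b k].  Were [b m < a m] for some [m], then [a m] would be
    obtuse and all the other [a i] acute, and stretching the latter to the [b i]
    multiplies the sine of their sum by strictly less than [lam]
    ([sinD_lt_scaled]); but these sines are [sin (a m)] and [sin (b m)], whose
    ratio is exactly [lam].  So [a k <= b k] for all [k], and as both families
    add up to [pi] they coincide. *)

(** * Sines of sums *)

Section SumsOfSines.
Variable R : realType.
Implicit Types (lam : R) (I : Type).

Lemma le_cos_pi (x y : R) : 0 <= x -> x <= y -> y <= pi -> cos y <= cos x.
Proof.
rewrite [x <= y]le_eqVlt => x0 /predU1P[->//|xy] ypi.
by rewrite ltW// ltr_cos ?in_itv/=; lra.
Qed.

Lemma sinD_scaled_gap lam (a b c d : R) : sin b = lam * sin a ->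
  lam * sin (a + c) - sin (b + d) = sin b * (cos c - cos d) +
    cos a * (lam * sin c - sin d) + (cos a - cos b) * sin d.
Proof. by move=> sb; rewrite !sinD mulrDr !mulrA -sb; ring. Qed.

Lemma sinD_le_scaled lam (a b c d : R) :
  0 <= a -> a <= b -> a <= pi / 2 -> 0 <= c -> c <= d -> b + d <= pi ->
  sin b = lam * sin a -> sin d <= lam * sin c ->
  sin (b + d) <= lam * sin (a + c).
Proof.
move=> a0 ab api c0 cd bdpi sb sd.
have cosab : cos b <= cos a by apply: le_cos_pi; lra.
have coscd : cos d <= cos c by apply: le_cos_pi; lra.
have sb0 : 0 <= sin b by rewrite sin_ge0_pi//; lra.
have sd0 : 0 <= sin d by rewrite sin_ge0_pi//; lra.
have ca0 : 0 <= cos a by rewrite cos_ge0_pihalf//; lra.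
rewrite -subr_ge0 sinD_scaled_gap//.
by rewrite !addr_ge0 ?mulr_ge0 ?subr_ge0.
Qed.

(** Since [cos] decreases, the coefficients in
    [sin (x + y) = sin x * cos y + cos x * sin y] get smaller when the angles
    grow: if the two sines are multiplied by at most [lam], the sine of the sum
    is multiplied by less than [lam]. *)
Lemma sinD_lt_scaled lam (a b c d : R) :
  0 <= a -> a < b -> a <= pi / 2 -> 0 <= c -> c <= d -> 0 < d -> b + d <= pi ->
  sin b = lam * sin a -> sin d <= lam * sin c ->
  sin (b + d) < lam * sin (a + c).
Proof.
move=> a0 ab api c0 cd d0 bdpi sb sd.
have cosab : cos b < cos a by rewrite ltr_cos ?in_itv/=; lra.
have coscd : cos d <= cos c by apply: le_cos_pi; lra.
have sb0 : 0 <= sin b by rewrite sin_ge0_pi//; lra.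
have sd0 : 0 < sin d by rewrite sin_gt0_pi//; lra.
have ca0 : 0 <= cos a by rewrite cos_ge0_pihalf//; lra.
rewrite -subr_gt0 sinD_scaled_gap//.
by rewrite ltr_wpDl ?addr_ge0 ?mulr_ge0 ?mulr_gt0 ?subr_ge0 ?subr_gt0.
Qed.

Lemma sin_sum_le_scaled I (r : seq I) (P : pred I) lam (a b : I -> R) :
  (forall i, P i -> 0 <= a i <= b i) -> (forall i, P i -> a i <= pi / 2) ->
  (forall i, P i -> sin (b i) = lam * sin (a i)) ->
  \sum_(i <- r | P i) b i <= pi ->
  sin (\sum_(i <- r | P i) b i) <= lam * sin (\sum_(i <- r | P i) a i).
Proof.
move=> ab api sab; elim: r => [|i r IHr]; first by rewrite !big_nil sin0 mulr0.
rewrite !big_cons; case: ifP => // Pi bpi; have /andP[ai0 abi] := ab i Pi.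
have S0 : 0 <= \sum_(j <- r | P j) a j by apply: sumr_ge0 => j /ab/andP[].
have SS : \sum_(j <- r | P j) a j <= \sum_(j <- r | P j) b j.
  by apply: ler_sum => j /ab/andP[].
by apply: sinD_le_scaled => //; [exact: api|exact: sab|apply: IHr; lra].
Qed.

Lemma sinD_lt (a b : R) : 0 < a -> 0 < b -> a + b <= pi ->
  sin (a + b) < sin a + sin b.
Proof.
move=> a0 b0 abpi.
have cos_lt1 (x : R) : 0 < x -> x <= pi -> cos x < 1.
  by move=> x0 xpi; rewrite -cos0 ltr_cos ?in_itv/=; lra.
have ca := cos_lt1 a; have cb := cos_lt1 b.
have sa : 0 < sin a by rewrite sin_gt0_pi//; lra.
have sb : 0 < sin b by rewrite sin_gt0_pi//; lra.
by rewrite sinD; nra.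
Qed.

Lemma sin_sum_le I (r : seq I) (P : pred I) (a : I -> R) :
  (forall i, P i -> 0 < a i) -> \sum_(i <- r | P i) a i <= pi ->
  sin (\sum_(i <- r | P i) a i) <= \sum_(i <- r | P i) sin (a i).
Proof.
move=> a0; elim: r => [|i r IHr]; first by rewrite !big_nil sin0.
rewrite !big_cons; case: ifP => // /a0 ai0 Spi.
have : 0 <= \sum_(j <- r | P j) a j by apply: sumr_ge0 => j /a0/ltW.
rewrite le_eqVlt => /predU1P[S0|S0].
  move: IHr; rewrite -S0 addr0 sin0; have := pi_ge0 R; lra.
by apply: le_trans (ltW (sinD_lt _ _ _)) _ => //; rewrite lerD2l IHr//; lra.
Qed.

End SumsOfSines.

(** * Estimates and continuity for the arcsine *)

Section Arcsine.
Variable R : realType.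

Lemma sin_mean_value (x : R) :
  0 < x -> exists2 z, 0 < z < x & sin x = cos z * x.
Proof.
move=> x0; have [|z] := @MVT R sin cos 0 x x0.
  by apply: continuous_subspaceT; exact: continuous_sin.
by rewrite in_itv/= sin0 !subr0 => z0x sxE; exists z.
Qed.

Lemma le_asin (y : R) : 0 <= y <= 1 -> y <= asin y.
Proof.
move=> /andP[y0 y1]; have yI : -1 <= y <= 1 by lra.
have sa : sin (asin y) = y by rewrite asinK.
have pi0 := pi_gt0 R.
have [->|yn0] := eqVneq y 0.
  by rewrite -[X in asin X]sin0 sinK ?in_itv/=; lra.
have [a_le0|a_gt0] := leP (asin y) 0.
  have : 0 <= sin (- asin y).
    have := asin_geNpi2 yI => ?.
    by rewrite sin_ge0_pi//; lra.
  by rewrite sinN sa; lra.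
have [z _] := sin_mean_value a_gt0; rewrite sa => yE.
by have := cos_le1 z; nra.
Qed.

(** The composite is continuous at the points where [f] takes the values [1] and
    [-1] as well, although [asin] itself is continuous there only from inside
    [[-1, 1]]; such points occur below when the longest side is not unique. *)
Lemma continuous_asin_comp (f : R -> R) : continuous f ->
  (forall x, -1 <= f x <= 1) -> continuous (asin \o f).
Proof.
move=> cf fI x W WN.
have pi0 := pi_gt0 R.
have asin_cont : {within `[-1, 1], continuous (@asin R)}%classic.
  rewrite -sin_pihalf -sinN.
  apply: segment_can_le_continuous; first by lra.
    by apply: continuous_subspaceT; exact: continuous_sin.
  exact: sinK.
have /subspace_continuousP/(_ (f x)) := asin_cont.
rewrite /= in_itv/= => /(_ (fI x) W WN) asinW.
refine (@filterS _ _ (nbhs_filter x) _ _ _ (cf x _ asinW)) => z; apply.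
by rewrite /= in_itv/= fI.
Qed.

End Arcsine.

(** * Half central angles with prescribed side lengths *)

(** [l k = d * sin (a k)] is the length of the chord that subtends the central
    angle [2 * a k] in a circle of diameter [d].  An obtuse [a k] belongs to a
    side that separates the polygon from the center. *)
Definition half_central_angles (R : realType) n (d : R) (l a : 'I_n -> R) :=
  [/\ forall k, 0 < a k, \sum_k a k = pi & forall k, l k = d * sin (a k)].

Lemma third_index n (k j : 'I_n) : (3 <= n)%N ->
  exists i : 'I_n, (i != k) && (i != j).
Proof.
move=> n_ge3; have /card_gt0P[i] : (0 < #|[predC pred2 k j]|)%N.
  have := cardC (pred2 k j); rewrite card2 card_ord => cE.
  by move: cE n_ge3; case: #|_| => // <-; case: (k != j).
by rewrite !inE negb_or => ij; exists i.
Qed.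

Section Angles.
Variables (R : realType) (n : nat) (n_ge3 : (3 <= n)%N).
Implicit Types (l a b : 'I_n -> R) (d e : R).

Lemma sumr_gt0_off2 a (k j : 'I_n) : (forall i, 0 < a i) ->
  0 < \sum_(i < n | (i != k) && (i != j)) a i.
Proof.
move=> a0; have [i ikj] := third_index k j n_ge3.
rewrite (bigD1 i)//= ltr_pwDl ?sumr_ge0// => h _.
exact: ltW.
Qed.

Lemma half_central_angles_polygon_inequality d l a :
  0 < d -> half_central_angles d l a ->
  forall k, l k < \sum_(i < n | i != k) l i.
Proof.
move=> d0 [a0 api la] k.
have -> : \sum_(i < n | i != k) l i = d * \sum_(i < n | i != k) sin (a i).
  by rewrite mulr_sumr; apply: eq_bigr => i _; rewrite la.
rewrite la ltr_pM2l//.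
(* [sin (a k)] is the sine of the supplement of [a k], the sum of the others. *)
have akE : a k = pi - \sum_(i < n | i != k) a i.
  by rewrite -api (bigD1 k)//= addrK.
have [j /andP[jk _]] := third_index k k n_ge3.
have rest0 := sumr_gt0_off2 k j a0.
have ak0 := a0 k; have aj0 := a0 j.
have -> : sin (a k) = sin (\sum_(i < n | i != k) a i).
  by rewrite akE addrC sinDpi sinN opprK.
rewrite (bigD1 j)// [X in _ < X](bigD1 j)//=.
rewrite (bigD1 j)//= in akE.
apply: lt_le_trans (sinD_lt _ _ _) _ => //; first by lra.
by rewrite lerD2l sin_sum_le//; lra.
Qed.

(** The smaller circle has the larger angles.  This is false for a single
    chord, because an obtuse angle decreases when its sine grows; the constraint
    on the sum of all the angles is what rules this out. *)
Lemma half_central_angles_le d e l a b : (forall k, 0 < l k) ->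
  0 < d -> 0 < e -> e <= d ->
  half_central_angles d l a -> half_central_angles e l b ->
  forall k, a k <= b k.
Proof.
move=> l0 d0 e0 ed [a0 api la] [b0 bpi lb].
have pi0 := pi_gt0 R.
pose lam := d / e.
have lam1 : 1 <= lam by rewrite ler_pdivlMr ?mul1r.
have sab k : sin (b k) = lam * sin (a k).
  apply: (mulfI (lt0r_neq0 e0)); rewrite -lb la /lam.
  by field; rewrite lt0r_neq0.
have sa0 k : 0 < sin (a k) by rewrite -(pmulr_rgt0 _ d0) -la.
have acute_le k : a k <= pi / 2 -> a k <= b k.
  move=> akpi; rewrite leNgt; apply/negP => bak.
  have : sin (b k) < sin (a k) by rewrite ltr_sin ?in_itv/=; have := b0 k; lra.
  by rewrite sab ltNge ler_peMl// ltW.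
move=> m; rewrite leNgt; apply/negP => bam.
have am_obtuse : pi / 2 < a m.
  by rewrite ltNge; apply/negP => /acute_le; rewrite leNgt bam.
have amE : \sum_(i < n | i != m) a i = pi - a m.
  by rewrite -api [in RHS](bigD1 m)//= addrAC subrr add0r.
have bmE : \sum_(i < n | i != m) b i = pi - b m.
  by rewrite -bpi [in RHS](bigD1 m)//= addrAC subrr add0r.
have acute i : i != m -> a i <= pi / 2.
  move=> im; rewrite (bigD1 i)//= in amE.
  have : 0 <= \sum_(j < n | (j != m) && (j != i)) a j.
    by apply: sumr_ge0 => j _; exact: ltW.
  by lra.
have [j jm abj] : exists2 j, j != m & a j < b j.
  have [/existsP[j /andP[jm abj]]|] :=
    boolP [exists j, (j != m) && (a j < b j)].
    by exists j.
  rewrite negb_exists => /forallP/= ab.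
  have : \sum_(i < n | i != m) b i <= \sum_(i < n | i != m) a i.
    by apply: ler_sum => i im; move: (ab i); rewrite im/= -leNgt.
  by rewrite amE bmE; lra.
(* The two sums are supplementary to [b m] and [a m]. *)
suff : sin (\sum_(i < n | i != m) b i) < lam * sin (\sum_(i < n | i != m) a i).
  by rewrite amE bmE ![pi - _]addrC !sinDpi !sinN !opprK sab ltxx.
have b_le_pi : \sum_(i < n | i != m) b i <= pi.
  by rewrite bmE; have := b0 m; lra.
have aj0 := a0 j; have bj0 := b0 j.
(* Strictness comes from the index [j]; all the other ones are lumped together
   and compared weakly. *)
rewrite (bigD1 j)//= in b_le_pi.
rewrite (bigD1 j)// [in X in _ < X](bigD1 j)//=.
apply: sinD_lt_scaled => //; first exact: ltW.
- exact: acute.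
- by apply: sumr_ge0 => i _; exact: ltW.
- by apply: ler_sum => i /andP[im _]; apply: acute_le; exact: acute.
- exact: sumr_gt0_off2.
apply: sin_sum_le_scaled => //.
- by move=> i /andP[im _]; rewrite ltW//= acute_le// acute.
- by move=> i /andP[im _]; exact: acute.
by lra.
Qed.

Lemma half_central_angles_uniq d e l a b : (forall k, 0 < l k) ->
  0 < d -> 0 < e ->
  half_central_angles d l a -> half_central_angles e l b ->
  d = e /\ forall k, a k = b k.
Proof.
move=> l0; wlog ed : d e a b / e <= d => [wlog_ed|] d0 e0 aP bP.
  have [ed|/ltW de] := leP e d; first exact: wlog_ed.
  by have [-> ab] := wlog_ed _ _ _ _ de e0 d0 bP aP; split=> // k; rewrite ab.
have ab_le := half_central_angles_le l0 d0 e0 ed aP bP.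
case: aP bP => a0 api la [b0 bpi lb].
have ab k : a k = b k.
  apply/eqP; rewrite eq_sym -subr_eq0; apply/eqP.
  apply: (@psumr_eq0P _ _ xpredT (fun i => b i - a i)) => //.
    by move=> i _; rewrite subr_ge0.
  by rewrite sumrB api bpi subrr.
split=> //; pose k0 : 'I_n := Ordinal (ltnW (ltnW n_ge3)).
have sa0 : sin (a k0) != 0.
  by have := l0 k0; rewrite la; apply: contraTneq => ->; rewrite mulr0 ltxx.
by apply: (mulIf sa0); rewrite -la lb ab.
Qed.

(** Intermediate value theorem for [F], the sum of all the angles as a function
    of the angle [x] of a longest side [m]. *)
Lemma half_central_angles_exist l : (forall k, 0 < l k) ->
  (forall k, l k < \sum_(i < n | i != k) l i) ->
  exists2 d, 0 < d & exists a, half_central_angles d l a.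
Proof.
move=> l0 poly.
have pi0 := pi_gt0 R.
pose k0 : 'I_n := Ordinal (ltnW (ltnW n_ge3)).
have [m lm] : exists m, forall i, l i <= l m.
  by exists [arg max_(i > k0) l i]%O; case: arg_maxP => // i _ li j; exact: li.
pose c i := l i / l m.
have c0 i : 0 < c i by rewrite divr_gt0.
have c1 i : c i <= 1 by rewrite ler_pdivrMr ?mul1r.
pose C := \sum_(i < n | i != m) c i.
have C1 : 1 < C by rewrite /C -mulr_suml ltr_pdivlMr ?mul1r.
pose F x := x + \sum_(i < n | i != m) asin (c i * sin x).
have cI i x : -1 <= c i * sin x <= 1.
  by have := c0 i; have := c1 i; have := sin_geN1 x; have := sin_le1 x; nra.
have Fcont : continuous F.
  move=> x; apply: cvgD; first exact: cvg_id.
  apply: cvg_big => [|i _]; first exact: add_continuous.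
  apply: (@continuous_asin_comp R (fun x => c i * sin x)) => //.
  by move=> y; apply: cvgM; [exact: cvg_cst|exact: continuous_sin].
have F0 : F 0 = 0.
  rewrite /F add0r big1// => i _; rewrite sin0 mulr0 -[X in asin X]sin0.
  by rewrite sinK ?in_itv/=; lra.
have [psi /andP[psi0 psi1] psiF] :
    exists2 psi, 0 < psi < pi & pi < F (pi - psi).
  (* [asin y >= y] gives [F (pi - psi) >= pi - psi + C * sin psi], and
     [sin psi = cos z * psi] for some [z < psi], where [cos z > cos psi];
     so [cos psi = C^-1] is just small enough for [C * sin psi > psi]. *)
  have CI : 0 < C^-1 < 1 by rewrite invr_gt0 invf_lt1; lra.
  have cpsi : cos (acos C^-1) = C^-1 by rewrite acosK ?in_itv/=; lra.
  have psi0 : 0 < acos C^-1 by rewrite acos_gt0; lra.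
  have psipi : acos C^-1 < pi by rewrite acos_ltpi; lra.
  exists (acos C^-1); first by rewrite psi0.
  set psi := acos _ in cpsi psi0 psipi *.
  have [z /andP[z0 zpsi] sz] := sin_mean_value psi0.
  have Cz : 1 < C * cos z.
    rewrite -(@divff _ C) ?ltr_pM2l ?lt0r_neq0 //; try lra.
    by rewrite -cpsi ltr_cos ?in_itv/=; lra.
  have ssum : C * sin psi <= \sum_(i < n | i != m) asin (c i * sin (pi - psi)).
    rewrite mulr_suml addrC sinDpi sinN opprK.
    apply: ler_sum => i _; apply: le_asin.
    have := cI i psi; have := c0 i.
    have : 0 <= sin psi by rewrite sin_ge0_pi//; lra.
    by move=> ? ? /andP[_ ->]; rewrite mulr_ge0// ltW.
  have : psi < C * sin psi by rewrite sz mulrA ltr_pMl.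
  by rewrite /F; lra.
have [|||x] := @IVT R F 0 (pi - psi) pi.
- by lra.
- by apply: continuous_subspaceT.
- by rewrite F0 ge_min le_max pi_ge0/= (ltW psiF) orbT.
rewrite in_itv/= => /andP[x_ge0 xpsi] Fx.
have x0 : 0 < x.
  rewrite lt_def x_ge0 andbT; apply/eqP => x0.
  by move: Fx; rewrite x0 F0; lra.
have sx0 : 0 < sin x by rewrite sin_gt0_pi//; lra.
exists (l m / sin x); first by rewrite divr_gt0.
exists (fun i => if i == m then x else asin (c i * sin x)); split.
- move=> k; case: ifP => // _.
  have cs0 : 0 < c k * sin x by rewrite mulr_gt0.
  have /andP[_ cs1] := cI k x.
  by rewrite (lt_le_trans cs0)// le_asin// ltW.
- rewrite -Fx (bigD1 m)//= eqxx; congr (_ + _).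
  by apply: eq_bigr => i /negPf ->.
- move=> k; case: eqP => [->|_]; first by rewrite divfK ?lt0r_neq0.
  rewrite asinK ?in_itv//= /c.
  by field; rewrite !lt0r_neq0.
Qed.

End Angles.

(** * Polygons inscribed in a circle *)

Section Geometry.
Variable R : realType.
Implicit Types (c : R * R) (r w z t : R) (s : bool).

(** The vertex [j] is a natural number so that [j = n] stands for vertex [0]
    reached again after one turn. *)
Definition angle_before n (a : 'I_n -> R) (j : nat) : R :=
  \sum_(i < n | (i < j)%N) a i.

Lemma angle_beforeS n (a : 'I_n -> R) (k : 'I_n) :
  angle_before a k.+1 = angle_before a k + a k.
Proof.
rewrite /angle_before (bigD1 k)//= addrC; congr (_ + _).
by apply: eq_bigl => i; rewrite ltnS [RHS]ltn_neqAle andbC.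
Qed.

Lemma angle_before_all n (a : 'I_n -> R) : angle_before a n = \sum_k a k.
Proof. by apply: eq_bigl => i; rewrite ltn_ord. Qed.

Lemma angle_before_lt n (a : 'I_n -> R) (i j : nat) : (forall k, 0 < a k) ->
  (i < j <= n)%N -> angle_before a i < angle_before a j.
Proof.
move=> a0 /andP[ij jn]; pose i' := Ordinal (leq_trans ij jn).
rewrite /angle_before [ltRHS](bigID (fun k : 'I_n => (k < i)%N))/=.
rewrite [X in _ < X + _](eq_bigl (fun k : 'I_n => (k < i)%N)); last first.
  by move=> k; apply: andb_idl => /ltn_trans; apply.
rewrite ltrDl (bigD1 i')/= ?ij ?ltnn// ltr_pwDl// sumr_ge0// => k _.
exact: ltW.
Qed.

Lemma sin_signM s t : sin ((-1) ^+ s * t) = (-1) ^+ s * sin t.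
Proof. by case: s; rewrite ?mulN1r ?mul1r ?sinN. Qed.

Lemma cos_signM s t : cos ((-1) ^+ s * t) = cos t.
Proof. by case: s; rewrite ?mulN1r ?mul1r ?cosN. Qed.

Lemma circle_point_turn c r s t :
  circle_point c r ((-1) ^+ s * (t + 2 * pi)) =
  circle_point c r ((-1) ^+ s * t).
Proof.
have e : t + 2 * pi = t + pi *+ 2 by rewrite mulr_natl.
by rewrite /circle_point !cos_signM !sin_signM e cosD2pi sinD2pi.
Qed.

(** The endpoints of the chord are written symmetrically about the direction [w]
    of its perpendicular bisector, so that the differences of their coordinates
    are products of sines and cosines. *)
Lemma edist_circle_point c r w z : 0 <= r ->
  edist (circle_point c r (w + z)) (circle_point c r (w - z)) =
  2 * r * `|sin z|.
Proof.
move=> r0; rewrite /edist /circle_point/= !cosB !sinB !cosD !sinD.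
rewrite [X in Num.sqrt X](_ : _ =
  (2 * r * sin z) ^+ 2 * (cos w ^+ 2 + sin w ^+ 2)); last by ring.
by rewrite cos2Dsin2 mulr1 sqrtr_sqr normrM ger0_norm// mulr_ge0.
Qed.

(** The sign [s] is the orientation: counterclockwise for [false], clockwise for
    [true]. *)
Definition inscribed n c r s w (a : 'I_n -> R) (p : 'I_n -> R * R) :=
  forall k, p k = circle_point c r ((-1) ^+ s * (w + 2 * angle_before a k)).

Lemma inscribed_side_length n c r s w (a : 'I_n -> R) p : 0 <= r ->
  (forall k, 0 < a k) -> \sum_k a k = pi -> inscribed c r s w a p ->
  forall k, side_length p k = 2 * r * sin (a k).
Proof.
move=> r0 a0 api pE k.
(* For the last side this uses that a full turn leads back to vertex [0]. *)
have -> : side_length p k =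
    edist (circle_point c r ((-1) ^+ s * (w + 2 * angle_before a k.+1))) (p k).
  rewrite /side_length pE /=; congr (edist _ _).
  have [kn|] := ltnP k.+1 n; first by rewrite modn_small.
  rewrite leq_eqVlt ltnNge ltn_ord orbF => /eqP kn.
  rewrite -kn modnn angle_before_all api circle_point_turn.
  by rewrite /angle_before big_pred0_eq mulr0 addr0.
rewrite pE angle_beforeS.
have ak_pi : a k <= pi.
  by rewrite -api (bigD1 k)//= lerDl sumr_ge0// => i _; exact: ltW.
set u := (-1) ^+ s.
set mid := u * (w + 2 * angle_before a k + a k).
rewrite (_ : _ * _ = mid + u * a k); last by rewrite /mid; ring.
rewrite (_ : u * (w + _) = mid - u * a k); last by rewrite /mid; ring.
rewrite edist_circle_point// sin_signM normrM normrX normrN1 expr1n mul1r.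
by rewrite ger0_norm// sin_ge0_pi// ltW//=.
Qed.

Lemma inscribed_cyclic_polygon n c r s w (a : 'I_n -> R) p : 0 < r ->
  (forall k, 0 < a k) -> \sum_k a k = pi -> inscribed c r s w a p ->
  cyclic_polygon p.
Proof.
move=> r0 a0 api pE; exists c, r; split=> //.
exists (fun k => (-1) ^+ s * (w + 2 * angle_before a k)); split=> //.
have turns : one_turn (fun k : 'I_n => w + 2 * angle_before a k).
  move=> i j ij.
  have ? : angle_before a i < angle_before a j.
    by rewrite angle_before_lt// ij ltnW.
  have ? : angle_before a j < pi.
    by rewrite -api -angle_before_all angle_before_lt// ltn_ord/=.
  have ? : 0 <= angle_before a i by apply: sumr_ge0 => k _; exact: ltW.
  by apply/andP; split; lra.
by case: (s); [right|left] => i j /turns;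
  rewrite ?mul1r ?mulN1r ?opprK ?expr1 ?expr0.
Qed.

(** The half central angles are half the increments of the angular positions;
    the last increment leads from vertex [n - 1] to vertex [0], whose position
    is counted one full turn later. *)
Lemma cyclic_polygon_inscribed n (p : 'I_n -> R * R) : (2 <= n)%N ->
  cyclic_polygon p -> exists c r s w (a : 'I_n -> R),
  [/\ 0 < r, forall k, 0 < a k, \sum_k a k = pi & inscribed c r s w a p].
Proof.
case: n p => [//|n] p n_gt0 [c [r [r0 [t [turns pE]]]]].
have [s {}turns] : exists s, one_turn (fun k => (-1) ^+ s * t k).
  by case: turns => turns; [exists false|exists true] => i j /turns;
    rewrite ?expr0 ?expr1 ?mul1r ?mulN1r.
pose u k := (-1) ^+ s * t k.
(* The angular positions, extended by [v n], a full turn after [v 0]. *)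
pose v j := if (j < n.+1)%N then u (inord j) else u ord0 + 2 * pi.
have v_ord (k : 'I_n.+1) : v k = u k by rewrite /v ltn_ord inord_val.
pose a (k : 'I_n.+1) := (v k.+1 - v k) / 2.
have turnE j : (j <= n.+1)%N -> angle_before a j = (v j - v 0%N) / 2.
  move=> jn; rewrite -telescope_sumr// mulr_suml big_mkord.
  by rewrite (big_ord_widen _ (fun i => (v i.+1 - v i) / 2) jn).
exists c, r, s, (v 0%N), a; split=> //.
- move=> k; rewrite /a divr_gt0// subr_gt0 v_ord {1}/v.
  case: ltnP => kn; first by have := turns k (inord k.+1);
    rewrite inordK// => /(_ (ltnSn k))/andP[].
  have kE : k = n :> nat by apply/eqP; rewrite eqn_leq -ltnS ltn_ord.
  by have := turns ord0 k; rewrite kE => /(_ n_gt0)/andP[].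
- have v_end : v n.+1 = v 0%N + 2 * pi by rewrite (v_ord ord0) /v ltnn.
  by rewrite -angle_before_all turnE// v_end; field.
move=> k; rewrite turnE ?(ltnW (ltn_ord k))// v_ord pE; congr circle_point.
rewrite (_ : v 0%N + _ = u k); last by field.
by rewrite /u mulrA -expr2 sqrr_sign mul1r.
Qed.

(** A rotation by [z], preceded by a reflection in a horizontal line if [s] is
    [true], that takes [c] to [c']. *)
Definition rigid_motion c c' s z (x : R * R) : R * R :=
  (c'.1 + (cos z * (x.1 - c.1) - (-1) ^+ s * sin z * (x.2 - c.2)),
   c'.2 + (sin z * (x.1 - c.1) + (-1) ^+ s * cos z * (x.2 - c.2))).

Lemma rigid_motion_isometry c c' s z : plane_isometry (rigid_motion c c' s z).
Proof.
have sgn2 : (-1) ^+ s * (-1) ^+ s = 1 :> R by rewrite -expr2 sqrr_sign.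
split.
  exists (fun y => (c.1 + (cos z * (y.1 - c'.1) + sin z * (y.2 - c'.2)),
    c.2 + (-1) ^+ s * (cos z * (y.2 - c'.2) - sin z * (y.1 - c'.1)))).
  - move=> [x y]; rewrite /rigid_motion/=; congr (_, _).
      transitivity (c.1 + (cos z ^+ 2 + sin z ^+ 2) * (x - c.1)); first by ring.
      by rewrite cos2Dsin2; ring.
    transitivity (c.2 + ((-1) ^+ s * (-1) ^+ s) *
      (cos z ^+ 2 + sin z ^+ 2) * (y - c.2)); first by ring.
    by rewrite cos2Dsin2 sgn2; ring.
  - move=> [x y]; rewrite /rigid_motion/=; congr (_, _).
      transitivity (c'.1 +
        (cos z ^+ 2 + (-1) ^+ s * (-1) ^+ s * sin z ^+ 2) * (x - c'.1) +
        cos z * sin z * (1 - (-1) ^+ s * (-1) ^+ s) * (y - c'.2)).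
        by ring.
      by rewrite sgn2 mul1r cos2Dsin2; ring.
    transitivity (c'.2 +
      ((-1) ^+ s * (-1) ^+ s * cos z ^+ 2 + sin z ^+ 2) * (y - c'.2) +
      cos z * sin z * (1 - (-1) ^+ s * (-1) ^+ s) * (x - c'.1)).
      by ring.
    by rewrite sgn2 mul1r cos2Dsin2; ring.
move=> x y; rewrite /edist; congr Num.sqrt; rewrite /rigid_motion/=.
transitivity ((cos z ^+ 2 + sin z ^+ 2) * ((x.1 - y.1) ^+ 2 +
   (-1) ^+ s * (-1) ^+ s * (x.2 - y.2) ^+ 2)); first by ring.
by rewrite cos2Dsin2 sgn2; ring.
Qed.

Lemma rigid_motion_circle_point c c' s z r t :
  rigid_motion c c' s z (circle_point c r t) =
  circle_point c' r (z + (-1) ^+ s * t).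
Proof.
rewrite /rigid_motion /circle_point/= cosD sinD cos_signM sin_signM.
by congr (_, _); ring.
Qed.

Lemma inscribed_congruent n c c' r s s' w w' (a : 'I_n -> R) p q :
  inscribed c r s w a p -> inscribed c' r s' w' a q -> congruent p q.
Proof.
move=> pE qE.
exists (rigid_motion c c' (s (+) s') ((-1) ^+ s' * (w' - w))).
split=> [|k]; first exact: rigid_motion_isometry.
rewrite pE qE rigid_motion_circle_point; congr circle_point.
by case: s s' {pE qE} => [] []/=; ring.
Qed.

End Geometry.

Theorem theorem1 (R : realType) (n : nat) (n_ge3 : (3 <= n)%N)
    (l : 'I_n -> R) (l_gt0 : forall k, 0 < l k) :
  ((exists p : 'I_n -> R * R, cyclic_polygon p /\ has_side_lengths p l) <->
   (forall k : 'I_n, l k < \sum_(i < n | i != k) l i)) /\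
  ((forall k : 'I_n, l k < \sum_(i < n | i != k) l i) ->
   forall p q : 'I_n -> R * R,
     cyclic_polygon p -> has_side_lengths p l ->
     cyclic_polygon q -> has_side_lengths q l ->
     congruent p q).
Proof.
have angles p : cyclic_polygon p -> has_side_lengths p l ->
    exists c r s w a, [/\ 0 < r, half_central_angles (2 * r) l a &
      inscribed c r s w a p].
  move=> /(cyclic_polygon_inscribed (ltnW n_ge3))[c [r [s [w [a]]]]].
  move=> [r0 a0 api pE] pl; exists c, r, s, w, a; split=> //; split=> // k.
  by rewrite -pl (inscribed_side_length (ltW r0) a0 api pE).
split; first split.
- move=> [p [/angles pP /pP[c [r [s [w [a [r0 aP _]]]]]]]].
  by apply: half_central_angles_polygon_inequality aP => //; rewrite mulr_gt0.
- move=> /(half_central_angles_exist n_ge3 l_gt0)[d d0 [a [a0 api la]]].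
  have d2 : 0 < d / 2 by rewrite divr_gt0.
  pose p k := circle_point (0, 0) (d / 2)
    ((-1) ^+ false * (0 + 2 * angle_before a k)).
  have pE : inscribed (0, 0) (d / 2) false 0 a p by [].
  exists p; split; first exact: inscribed_cyclic_polygon pE.
  move=> k; rewrite (inscribed_side_length (ltW d2) a0 api pE) la.
  by field.
move=> _ p q /angles pP /pP[c [r [s [w [a [r0 aP pE]]]]]].
move=> /angles qP /qP[c' [r' [s' [w' [a' [r'0 a'P qE]]]]]].
have [||rr' aa'] := half_central_angles_uniq n_ge3 l_gt0 _ _ aP a'P.
- by rewrite mulr_gt0.
- by rewrite mulr_gt0.
have {}rr' : r = r' by lra.
apply: inscribed_congruent pE _ => k; rewrite qE rr'.
congr (circle_point _ _ (_ * (_ + 2 * _))).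
by apply: eq_bigr => i _; rewrite aa'.
Qed.
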